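(* Let $A \in \mathbb{H}^{m\times n}$ have rank $\nu$, let $S_1 \in \mathbb{H}^{n\times p}$ and $T_1 \in \mathbb{H}^{q\times m}$, and let $X = S_1 (T_1 A S_1)^{(1)} T_1$, where $(T_1AS_1)^{(1)}$ is a fixed but arbitrary $\{1\}$-inverse of $T_1AS_1$. Then: (a) $AXA=A$ if and only if $\operatorname{rank}(T_1AS_1)=\nu$. (b) $XAX=X$ and $\mathcal{R}_r(X)=\mathcal{R}_r(S_1)$ if and only if $\operatorname{rank}(T_1AS_1)=\operatorname{rank}(S_1)$. (c) $XAX=X$ and $\mathcal{N}_r(X)=\mathcal{N}_r(T_1)$ if and only if $\operatorname{rank}(T_1AS_1)=\operatorname{rank}(T_1)$. (d) $X$ is the unique matrix $A^{(2)}_{r,(S_1,T_1)}$, i.e. the unique matrix in $\mathbb{H}^{n\times m}$ satisfying $XAX=X$, $\mathcal{R}_r(X)=\mathcal{R}_r(S_1)$ and $\mathcal{N}_r(X)=\mathcal{N}_r(T_1)$, if and only if $\operatorname{rank}(T_1AS_1)=\operatorname{rank}(S_1)=\operatorname{rank}(T_1)$. (e) $X$ is the unique matrix $A^{(1,2)}_{r,(S_1,T_1)}$, i.e. the unique matrix in $\mathbb{H}^{n\times m}$ satisfying $AXA=A$, $XAX=X$, $\mathcal{R}_r(X)=\mathcal{R}_r(S_1)$ and $\mathcal{N}_r(X)=\mathcal{N}_r(T_1)$, if and only if $\operatorname{rank}(T_1AS_1)=\operatorname{rank}(S_1)=\operatorname{rank}(T_1)=\nu$.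
   Context: $\mathbb{H}$ denotes the real quaternions and $\mathbb{H}^{m\times n}$ the set of $m\times n$ quaternion matrices. For $B\in\mathbb{H}^{m\times n}$, the right range and right null space are $\mathcal{R}_r(B)=\{Bx : x\in\mathbb{H}^{n\times 1}\}\subseteq\mathbb{H}^{m\times 1}$ and $\mathcal{N}_r(B)=\{x\in\mathbb{H}^{n\times 1} : Bx=0\}$; these are subspaces of right quaternion vector spaces. The rank of $B$ is the maximal number of right linearly independent columns of $B$ (equivalently, the maximal number of left linearly independent rows). A $\{1\}$-inverse of $B\in\mathbb{H}^{m\times n}$ is any $Y\in\mathbb{H}^{n\times m}$ with $BYB=B$. *)

(* Defs.v *)
From HB Require Import structures.
From mathcomp Require Import all_boot all_order all_algebra.
From mathcomp Require Import ring.
From mathcomp Require Import boolp classical_sets reals.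

Set Implicit Arguments.
Unset Strict Implicit.
Unset Printing Implicit Defensive.

Import GRing.Theory.

Local Open Scope ring_scope.
Local Open Scope classical_set_scope.

(* [Quat a b c d] is a + b i + c j + d k. *)
Record quat (R : Type) := Quat { qre : R; qi : R; qj : R; qk : R }.

Section QuatRing.
Variable R : realType.
Implicit Types x y z : quat R.

Definition tuple_of_quat x := (qre x, qi x, qj x, qk x).
Definition quat_of_tuple (t : R * R * R * R) :=
  let: (a, b, c, d) := t in Quat a b c d.

Lemma tuple_of_quatK : cancel tuple_of_quat quat_of_tuple.
Proof. by case. Qed.

HB.instance Definition _ := Choice.copy (quat R) (can_type tuple_of_quatK).

Definition qzero : quat R := Quat 0 0 0 0.
Definition qone : quat R := Quat 1 0 0 0.
Definition qopp x := Quat (- qre x) (- qi x) (- qj x) (- qk x).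
Definition qadd x y :=
  Quat (qre x + qre y) (qi x + qi y) (qj x + qj y) (qk x + qk y).
Definition qmul x y :=
  Quat (qre x * qre y - qi x * qi y - qj x * qj y - qk x * qk y)
       (qre x * qi y + qi x * qre y + qj x * qk y - qk x * qj y)
       (qre x * qj y - qi x * qk y + qj x * qre y + qk x * qi y)
       (qre x * qk y + qi x * qj y - qj x * qi y + qk x * qre y).

Fact qaddA : associative qadd.
Proof. by move=> x y z; rewrite /qadd /= !addrA. Qed.
Fact qaddC : commutative qadd.
Proof. by move=> x y; congr Quat; exact: addrC. Qed.
Fact qadd0 : left_id qzero qadd.
Proof. by case=> a b c d; rewrite /qadd /= !add0r. Qed.
Fact qaddN : left_inverse qzero qopp qadd.
Proof. by move=> x; rewrite /qadd /= !addNr. Qed.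

HB.instance Definition _ :=
  GRing.isZmodule.Build (quat R) qaddA qaddC qadd0 qaddN.

Fact qmulA : associative qmul.
Proof. by move=> x y z; rewrite /qmul; congr Quat => /=; ring. Qed.
Fact qmul1l : left_id qone qmul.
Proof. by case=> a b c d; rewrite /qmul; congr Quat => /=; ring. Qed.
Fact qmul1r : right_id qone qmul.
Proof. by case=> a b c d; rewrite /qmul; congr Quat => /=; ring. Qed.
Fact qmulDl : left_distributive qmul qadd.
Proof. by move=> x y z; rewrite /qmul /qadd; congr Quat => /=; ring. Qed.
Fact qmulDr : right_distributive qmul qadd.
Proof. by move=> x y z; rewrite /qmul /qadd; congr Quat => /=; ring. Qed.
Fact qone_neq0 : qone != qzero.
Proof. by apply/eqP=> -[] /eqP; rewrite oner_eq0. Qed.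

HB.instance Definition _ := GRing.Zmodule_isNzRing.Build (quat R)
  qmulA qmul1l qmul1r qmulDl qmulDr qone_neq0.

End QuatRing.

Section QuatMatrix.
Variable R : realType.

Definition right_range m n (B : 'M[quat R]_(m, n)) : set 'cV[quat R]_m :=
  [set y | exists x : 'cV[quat R]_n, y = B *m x].

Definition right_null m n (B : 'M[quat R]_(m, n)) : set 'cV[quat R]_n :=
  [set x | B *m x = 0].

(* Scalars multiply the columns from the right; the library's [*:] would be
   a left action. *)
Definition right_free_cols m n (B : 'M[quat R]_(m, n)) (J : {set 'I_n}) : Prop :=
  forall a : 'I_n -> quat R,
    (forall i : 'I_m, \sum_(j in J) B i j * a j = 0) ->
    forall j, j \in J -> a j = 0.

(* [\rank] is only available over fields. *)
Definition qrank m n (B : 'M[quat R]_(m, n)) : nat :=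
  (\max_(J : {set 'I_n} | `[< right_free_cols B J >]) #|J|)%N.

Definition is_inv1 m n (B : 'M[quat R]_(m, n)) (Y : 'M[quat R]_(n, m)) : Prop :=
  B *m Y *m B = B.

Definition is_inv2 m n (A : 'M[quat R]_(m, n)) (X : 'M[quat R]_(n, m)) : Prop :=
  X *m A *m X = X.

Definition is_inv2_prescribed m n p q (A : 'M[quat R]_(m, n))
    (S : 'M[quat R]_(n, p)) (T : 'M[quat R]_(q, m)) (X : 'M[quat R]_(n, m)) :=
  [/\ is_inv2 A X, right_range X = right_range S & right_null X = right_null T].

Definition is_inv12_prescribed m n p q (A : 'M[quat R]_(m, n))
    (S : 'M[quat R]_(n, p)) (T : 'M[quat R]_(q, m)) (X : 'M[quat R]_(n, m)) :=
  [/\ is_inv1 A X, is_inv2 A X, right_range X = right_range S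
    & right_null X = right_null T].

End QuatMatrix.

(* Main.v *)
(* The proof rests on two facts about matrices over a division ring.  Every
   matrix has a {1}-inverse, so an inclusion of null spaces is a factorization
   through left multiplication.  And [qrank M] is the largest [s] such that
   [M *m F] is injective for some [F] with [s] columns; hence the rank of a
   product is bounded by the rank of each factor, and equality forces
   [M = M *m N *m U], resp. [N = V *m (M *m N)].  The five equivalences are
   then computations with these factorizations. *)

Require Import Defs.
From HB Require Import structures.
From mathcomp Require Import all_boot all_order all_algebra.
From mathcomp Require Import ring.
From mathcomp Require Import boolp classical_sets reals.

Set Implicit Arguments.
Unset Strict Implicit.
Unset Printing Implicit Defensive.

Local Open Scope ring_scope.

Import GRing.Theory Num.Theory.

(** * Linear algebra over a division ring *)

Definition mx_injective (D : nzRingType) m n (M : 'M[D]_(m, n)) : Prop :=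
  forall x : 'cV[D]_n, M *m x = 0 -> x = 0.

Section DivisionRing.
Variables (D : nzRingType).
Hypothesis linvD : forall x : D, x != 0 -> exists y, y * x = 1.

Lemma mulI_eq0 (x y : D) : x != 0 -> x * y = 0 -> y = 0.
Proof.
by move=> /linvD[z zx] xy0; rewrite -[y]mul1r -zx -mulrA xy0 mulr0.
Qed.

Lemma rinvD (x : D) : x != 0 -> exists y, x * y = 1.
Proof.
move=> /linvD[y yx]; have y0 : y != 0.
  by apply/eqP => y0; move/eqP: yx; rewrite y0 mul0r eq_sym oner_eq0.
have [z zy] := linvD y0.
by exists y; rewrite -[x]mul1r -zy -(mulrA z) yx mulr1.
Qed.

(** Some entry [c k 0] is nonzero and [a] is its left inverse. The explicit shape of the row lets
    [wide_mx_null] recover row [k] of a matrix from it. *)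
Lemma col_linv m (c : 'cV[D]_m) : c != 0 ->
  exists k a, a != 0 /\ (a *: delta_mx 0 k : 'rV[D]_m) *m c = 1%:M.
Proof.
move=> /matrix0Pn[k [j]]; rewrite ord1 => ck0.
have [a ack] := linvD ck0; exists k, a; split.
  by apply/eqP => a0; move/eqP: ack; rewrite a0 mul0r eq_sym oner_eq0.
by rewrite -scalemxAl -rowE; apply/matrixP => i i'; rewrite !ord1 !mxE.
Qed.

(** Induction on the number of columns: either the first column [c] equals [V G c] and a zero row is
    put on top of [G], or a row vector separates [c] from the range of [V]. *)
Lemma exists_inv1 m n (M : 'M[D]_(m, n)) :
  exists G : 'M[D]_(n, m), M *m G *m M = M.
Proof.
elim: n M => [|n IHn] M; first by exists 0; rewrite !thinmx0.
change ('M[D]_(m, 1 + n)) in (type of M).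
change (exists G : 'M[D]_(1 + n, m), M *m G *m M = M).
rewrite -(hsubmxK M); set c := lsubmx M; set V := rsubmx M.
have [G VGV] := IHn V.
have [Pc0|Pc0] := eqVneq (c - V *m G *m c) 0.
  exists (col_mx (0 : 'rV_m) G).
  rewrite mul_row_col mulmx0 add0r mul_mx_row VGV.
  by rewrite -(subr0_eq Pc0).
have [k [a [_]]] := col_linv Pc0; set w := _ *: _ => wPc.
(* Composing [w] with [1 - V G], which kills [V], gives [u c = 1] and [u V = 0]. *)
pose u := w - w *m V *m G.
have uc : u *m c = 1%:M by rewrite -wPc mulmxBl mulmxBr !mulmxA.
have uV : u *m V = 0 by rewrite mulmxBl -!mulmxA (mulmxA V) VGV subrr.
(* This matrix times [row_mx c V] is block diagonal with blocks [1] and [G V]. *)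
exists (col_mx u (G - G *m c *m u)).
rewrite mul_row_col mul_mx_row; congr row_mx.
  rewrite mulmxDl -mulmxA uc mulmx1 -mulmxA mulmxBl -(mulmxA (G *m c)) uc.
  by rewrite mulmx1 subrr mulmx0 addr0.
rewrite mulmxDl -mulmxA uV mulmx0 add0r -mulmxA mulmxBl -(mulmxA (G *m c)) uV.
by rewrite mulmx0 subr0 mulmxA.
Qed.

(** If [M G M = M], the columns of [1 - G M] are null vectors of [M], hence of [N]; so
    [N = N G M]. *)
Lemma null_sub_factor m n k (M : 'M[D]_(m, n)) (N : 'M[D]_(k, n)) :
  (forall x : 'cV[D]_n, M *m x = 0 -> N *m x = 0) -> exists W, N = W *m M.
Proof.
move=> sMN; have [G MGM] := exists_inv1 M; exists (N *m G).
apply/subr0_eq/matrixP => i j.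
have /(sMN _) : M *m col j (1%:M - G *m M) = 0.
  by rewrite colE mulmxA -colE mulmxBr mulmx1 mulmxA MGM subrr col0.
rewrite colE mulmxA -colE mulmxBr mulmx1 mulmxA => /matrixP/(_ i 0).
by rewrite !mxE.
Qed.

Lemma range_sub_factor m n k (M : 'M[D]_(m, n)) (N : 'M[D]_(m, k)) :
  (forall x : 'cV[D]_k, exists y : 'cV[D]_n, N *m x = M *m y) ->
  exists U, N = M *m U.
Proof.
move=> sNM.
have {}sNM j : exists y : 'cV[D]_n, col j N = M *m y.
  by have [y] := sNM (delta_mx j 0); rewrite -colE; exists y.
have [f fP] := choice sNM; exists (\matrix_(i, j) f j i 0).
apply/matrixP => i j; move/matrixP: (fP j) => /(_ i 0); rewrite !mxE => ->.
by apply: eq_bigr => l _; rewrite !mxE.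
Qed.

(** Gaussian elimination: one equation removes the first unknown, and fewer equations than unknowns
    remain. *)
Lemma wide_mx_null s r (M : 'M[D]_(s, r)) : (s < r)%N ->
  exists2 x : 'cV[D]_r, x != 0 & M *m x = 0.
Proof.
elim: s r M => [|s IHs] [//|r] M ltsr.
  exists (const_mx 1); last by rewrite [M]flatmx0 mul0mx.
  by apply/matrix0Pn; exists 0, 0; rewrite mxE oner_neq0.
change ('M[D]_(s.+1, 1 + r)) in (type of M).
change (exists2 x : 'cV[D]_(1 + r), x != 0 & M *m x = 0).
rewrite -(hsubmxK M); set c := lsubmx M; set V := rsubmx M.
have [c0|c0] := eqVneq c 0.
  exists (col_mx (1%:M : 'M_1) (0 : 'cV_r)).
    apply/matrix0Pn; exists (lshift r 0), 0.
    by rewrite col_mxEu mxE oner_neq0.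
  by rewrite mul_row_col c0 mul0mx mulmx0 addr0.
have [k [a [a0]]] := col_linv c0; set w := _ *: _ => wc.
(* [P] kills [c] and satisfies [w P = 0], so row [k] of [P V] is zero and can be deleted. *)
pose P : 'M[D]_s.+1 := 1%:M - c *m w.
have [y y0 Py] := IHs _ (row' k (P *m V)) ltsr.
have wP : w *m P = 0 by rewrite mulmxBr mulmx1 mulmxA wc mul1mx subrr.
have PVy : P *m V *m y = 0.
  apply/row_matrixP => i; rewrite row0.
  have [j ->|->] := unliftP k i.
    apply/matrixP => i' l; move/matrixP: Py => /(_ j l).
    rewrite row'Esub mul_rowsub_mx mxE [RHS]mxE => PVy0.
    by rewrite mxE PVy0 mxE.
  have : w *m (P *m V *m y) = 0 by rewrite !mulmxA wP !mul0mx.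
  rewrite -scalemxAl -rowE => /matrixP wPVy.
  apply/matrixP => i' l; rewrite [RHS]mxE; apply: (mulI_eq0 a0).
  by move: (wPVy i' l); rewrite [LHS]mxE [RHS]mxE.
(* The first coordinate is chosen so that the product becomes [P V y]. *)
exists (col_mx (- (w *m V *m y)) y).
  apply: contraNneq y0 => /eqP; rewrite col_mx_eq0 => /andP[_ /eqP->] //.
rewrite mul_row_col mulmxN addrC -[RHS]PVy !mulmxBl mul1mx.
by rewrite !mulmxA.
Qed.

(** A null vector with nonzero last entry could be divided by it on the right, which would put [N x]
    in the range of [N F]. *)
Lemma mx_injective_row_mx m n s (N : 'M[D]_(m, n)) (F : 'M[D]_(n, s))
    (x : 'cV[D]_n) :
  mx_injective (N *m F) -> (forall y : 'cV[D]_s, N *m x != N *m F *m y) ->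
  mx_injective (N *m row_mx F x).
Proof.
move=> injF xF z; rewrite -(vsubmxK z); set y := usubmx z; set b := dsubmx z.
rewrite mul_mx_row mul_row_col => yb0.
have [b0|b0] := eqVneq (b 0 0) 0.
  have {}b0 : b = 0 by apply/matrixP => i j; rewrite !ord1 b0 mxE.
  move: yb0; rewrite b0 mulmx0 addr0 => /injF ->; exact: col_mx0.
have [c bc] := rinvD b0.
have {}bc : b *m c%:M = 1%:M.
  apply/matrixP => i j; rewrite !ord1 mxE big_ord1.
  by rewrite [c%:M _ _]mxE [RHS]mxE eqxx !mulr1n bc.
have /eqP[] := xF (- (y *m c%:M)).
apply/eqP; rewrite mulmxN -addr_eq0 addrC !mulmxA.
by rewrite -[N *m x]mulmx1 -bc mulmxA -mulmxDl yb0 mul0mx.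
Qed.

End DivisionRing.

(** * Rank of quaternion matrices *)

Section QuaternionRank.
Variable R : realType.
Local Notation H := (quat R).

Lemma quat_linv (x : H) : x != 0 -> exists y, y * x = 1.
Proof.
case: x => a b c d x0; pose N := a ^+ 2 + b ^+ 2 + c ^+ 2 + d ^+ 2.
have N0 : N != 0.
  apply: contraNneq x0 => /eqP; rewrite /N.
  rewrite !paddr_eq0 ?addr_ge0 ?sqr_ge0 // !sqrf_eq0.
  by move=> /andP[/andP[/andP[/eqP-> /eqP->] /eqP->] /eqP->].
(* The conjugate divided by the squared norm. *)
exists (Quat (a / N) (- b / N) (- c / N) (- d / N)).
by congr Quat => /=; rewrite /N in N0 *; field.
Qed.

Lemma qrank_witness m n (M : 'M[H]_(m, n)) :
  exists2 J : {set 'I_n}, right_free_cols M J & #|J| = qrank M.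
Proof.
have free0 : `[< right_free_cols M finset.set0 >].
  by apply/asboolP => a _ j; rewrite inE.
rewrite /qrank (bigop.bigmax_eq_arg finset.set0) //.
by case: arg_maxnP => // J /asboolP freeJ _; exists J.
Qed.

(** [F] selects the columns in a free set [J] of maximal size. *)
Lemma qrank_injective m n (M : 'M[H]_(m, n)) :
  exists F : 'M[H]_(n, qrank M), mx_injective (M *m F).
Proof.
have [J freeJ <-] := qrank_witness M.
pose F : 'M[H]_(n, #|J|) := \matrix_(j, k) (j == enum_val k)%:R.
exists F => x MFx0.
have Fx k : (F *m x) (enum_val k) 0 = x k 0.
  rewrite mxE (bigD1 k) //= mxE eqxx mul1r big1 ?addr0 // => l lk.
  by rewrite mxE (inj_eq enum_val_inj) eq_sym (negbTE lk) mul0r.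
apply/matrixP => k j; rewrite !ord1 [RHS]mxE -Fx.
apply: (freeJ (fun j => (F *m x) j 0)); last exact: enum_valP.
move=> i; transitivity ((M *m (F *m x)) i 0); last by rewrite mulmxA MFx0 mxE.
rewrite [RHS]mxE [RHS](bigID (mem J)) /= [X in _ + X]big1 ?addr0 // => l lJ.
rewrite mxE big1 ?mulr0 // => t _; rewrite mxE.
by case: eqP lJ => [->|]; rewrite ?enum_valP // mul0r.
Qed.

(** A column [j] outside [J] creates a relation, which is divided on the right by its coefficient at
    [j]. The zero rows of [V] let [qrank_max] count only [#|J|] equations. *)
Lemma max_free_cols_span m n (M : 'M[H]_(m, n)) (J : {set 'I_n}) :
  right_free_cols M J -> #|J| = qrank M ->
  exists2 V : 'M[H]_n, M = M *m V & forall i j, i \notin J -> V i j = 0.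
Proof.
move=> freeJ cardJ.
have span j : exists v : 'cV[H]_n,
    (forall i, M i j = (M *m v) i 0) /\ (forall i, i \notin J -> v i 0 = 0).
  have [jJ|jJ] := boolP (j \in J).
    exists (delta_mx j 0); split=> i; first by rewrite -colE mxE.
    by rewrite mxE; case: eqP => [->|//]; rewrite jJ.
  have : ~ right_free_cols M (j |: J).
    move=> free_jJ; suff : (#|j |: J| <= qrank M)%N.
      by rewrite cardsU1 jJ -cardJ ltnn.
    by apply: (leq_bigmax_cond (j |: J)); apply/asboolP.
  move=> /existsNP[a] /not_implyP[a0] /existsNP[l] /not_implyP[ljJ al0].
  have sumJ i : M i j * a j + \sum_(k in J) M i k * a k = 0.
    by rewrite -[RHS](a0 i) big_setU1.
  (* Otherwise the relation would live on [J], and freeness would make all its coefficients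
     vanish. *)
  have aj0 : a j != 0.
    apply/eqP => aj0; case/setU1P: ljJ al0 => [-> //|lJ].
    move=> al0; apply: al0; apply: freeJ lJ => i.
    by move: (sumJ i); rewrite aj0 mulr0 add0r.
  have [c ac] := rinvD quat_linv aj0.
  exists (\col_k (if k \in J then - (a k * c) else 0)); split=> i; last first.
    by move=> /negbTE iJ; rewrite mxE iJ.
  rewrite mxE (bigID (mem J)) /= [X in _ + X]big1 ?addr0; last first.
    by move=> k /negbTE kJ; rewrite mxE kJ mulr0.
  have /eqP := sumJ i; rewrite addr_eq0 => /eqP sumJi.
  rewrite -[LHS]mulr1 -ac mulrA sumJi mulNr big_distrl -sumrN.
  by apply: eq_bigr => k kJ; rewrite mxE kJ mulrN mulrA.
have [f fP] := choice span; exists (\matrix_(i, j) f j i 0).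
  apply/matrixP => i j; rewrite (fP j).1 !mxE.
  by apply: eq_bigr => k _; rewrite mxE.
by move=> i j iJ; rewrite mxE (fP j).2.
Qed.

(** If [s] exceeded [#|J|], the rows of [V F] indexed by [J] would share a nonzero null vector [x],
    and [M F x = M V F x = 0]. *)
Lemma qrank_max m n s (M : 'M[H]_(m, n)) (F : 'M[H]_(n, s)) :
  mx_injective (M *m F) -> (s <= qrank M)%N.
Proof.
move=> injF; have [J freeJ cardJ] := qrank_witness M.
have [V MV V0] := max_free_cols_span freeJ cardJ.
rewrite leqNgt -cardJ; apply/negP => ltJs.
have [x x0 Vx] := wide_mx_null quat_linv
  (rowsub (fun k : 'I_#|J| => enum_val k) (V *m F)) ltJs.
case/eqP: x0; apply: injF; rewrite MV -!mulmxA.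
suff -> : V *m (F *m x) = 0 by rewrite mulmx0.
apply/matrixP => i j; have [iJ|iJ] := boolP (i \in J); last first.
  by rewrite !mxE big1 // => k _; rewrite V0 // mul0r.
move/matrixP: Vx => /(_ (enum_rank_in iJ i) j).
by rewrite mul_rowsub_mx mulmxA mxE enum_rankK_in // => ->; rewrite !mxE.
Qed.

Lemma qrankM_maxl m n k (M : 'M[H]_(m, n)) (N : 'M[H]_(n, k)) :
  (qrank (M *m N) <= qrank M)%N.
Proof.
by have [F] := qrank_injective (M *m N); rewrite -mulmxA; apply: qrank_max.
Qed.

Lemma qrankM_maxr m n k (M : 'M[H]_(m, n)) (N : 'M[H]_(n, k)) :
  (qrank (M *m N) <= qrank N)%N.
Proof.
have [F injF] := qrank_injective (M *m N); apply: (qrank_max (F := F)) => x.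
by move=> NFx0; apply: injF; rewrite -!mulmxA (mulmxA N) NFx0 mulmx0.
Qed.

(** If [M N x = 0] but [N x] is nonzero, appending [x] to an [F] with [M N F] injective keeps [N F]
    injective, so [N] has larger rank than [M N]. *)
Lemma qrank_eqr_factor m n k (M : 'M[H]_(m, n)) (N : 'M[H]_(n, k)) :
  qrank (M *m N) = qrank N -> exists V, N = V *m (M *m N).
Proof.
move=> eqr; apply: (null_sub_factor quat_linv) => x MNx.
apply: contra_eq eqr => Nx0; rewrite ltn_eqF //.
have [F injF] := qrank_injective (M *m N).
rewrite -addn1; apply: (qrank_max (F := row_mx F x)).
apply: (mx_injective_row_mx quat_linv) => [y NFy0|y].
  by apply: injF; rewrite -!mulmxA (mulmxA N) NFy0 mulmx0.
apply: contraNneq Nx0 => NxE; rewrite NxE.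
suff -> : y = 0 by rewrite mulmx0.
by apply: injF; rewrite -!mulmxA (mulmxA N) -NxE mulmxA.
Qed.

(** If [M x] is outside the range of [M N], appending [x] to [N F] shows that [M] has larger rank
    than [M N]. *)
Lemma qrank_eql_factor m n k (M : 'M[H]_(m, n)) (N : 'M[H]_(n, k)) :
  qrank (M *m N) = qrank M -> exists U, M = M *m N *m U.
Proof.
move=> eqr; apply: range_sub_factor => x.
have [F injF] := qrank_injective (M *m N).
apply: contrapT => notR; suff : (qrank (M *m N) < qrank M)%N.
  by rewrite eqr ltnn.
rewrite -addn1; apply: (qrank_max (F := row_mx (N *m F) x)).
apply: (mx_injective_row_mx quat_linv) => [|y]; first by rewrite mulmxA.
by apply/eqP => MxE; apply: notR; exists (F *m y); rewrite MxE !mulmxA.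
Qed.

Lemma right_range_factor m n k (M : 'M[H]_(m, n)) (N : 'M[H]_(m, k)) :
  right_range M = right_range N -> exists U, N = M *m U.
Proof.
move=> eqR; apply: range_sub_factor => x.
have : right_range N (N *m x) by exists x.
by rewrite -eqR.
Qed.

Lemma right_null_factor m n k (M : 'M[H]_(m, n)) (N : 'M[H]_(k, n)) :
  right_null M = right_null N -> exists W, N = W *m M.
Proof.
move=> eqN; apply: (null_sub_factor quat_linv) => x Mx0.
have : right_null M x by [].
by rewrite eqN.
Qed.

(** Both matrices equal [X A Z]: write [Z = X U] and [X = W Z]. *)
Lemma inv2_range_null_inj m n (A : 'M[H]_(m, n)) (X Z : 'M[H]_(n, m)) :
  is_inv2 A X -> is_inv2 A Z -> right_range X = right_range Z ->
  right_null X = right_null Z -> X = Z.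
Proof.
move=> XAX ZAZ /right_range_factor[U ZE] /esym/right_null_factor[W XE].
transitivity (X *m A *m Z).
  by rewrite {2}XE -!mulmxA (mulmxA Z) ZAZ -XE.
by rewrite {1}ZE mulmxA XAX -ZE.
Qed.

(** * Generalized inverses of the form [S Y T] *)

Section Sandwich.
Variables (m n p q : nat) (A : 'M[H]_(m, n)).
Variables (S : 'M[H]_(n, p)) (T : 'M[H]_(q, m)) (Y : 'M[H]_(p, q)).
Hypothesis invY : is_inv1 (T *m A *m S) Y.
Let X := S *m Y *m T.

(** Forward, [A = A X A X A] contains the factor [T A S]. Backward, [T A] and [A S] also have the
    rank of [A], so [A = V T A = A S U] and the {1}-inverse property applies between [V] and [U]. *)
Lemma sandwich_inv1P :
  A *m X *m A = A <-> qrank (T *m A *m S) = qrank A.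
Proof.
split=> [AXA|eqr].
  apply/eqP; rewrite eqn_leq; apply/andP; split.
    by rewrite (leq_trans (qrankM_maxl _ _)) // qrankM_maxr.
  have {1}-> : A = A *m S *m Y *m (T *m A *m S) *m (Y *m T *m A).
    by rewrite -{1}AXA -{1}AXA /X !mulmxA.
  by rewrite (leq_trans (qrankM_maxl _ _)) // qrankM_maxr.
have eqTA : qrank (T *m A) = qrank A.
  apply/eqP; rewrite eqn_leq qrankM_maxr /= -eqr; exact: qrankM_maxl.
have eqAS : qrank (A *m S) = qrank A.
  apply/eqP; rewrite eqn_leq qrankM_maxl /= -eqr -mulmxA; exact: qrankM_maxr.
have [V AV] := qrank_eqr_factor eqTA; have [U AU] := qrank_eql_factor eqAS.
rewrite {1}AV {2}AU /X.
transitivity (V *m (T *m A *m S *m Y *m (T *m A *m S)) *m U).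
  by rewrite !mulmxA.
by rewrite invY [RHS]AV {2}AU !mulmxA.
Qed.

(** Both directions pass through [X A S = S], obtained from [S = X U] or from [S = V T A S]. *)
Lemma sandwich_rangeP :
  X *m A *m X = X /\ right_range X = right_range S <->
  qrank (T *m A *m S) = qrank S.
Proof.
split=> [[XAX /right_range_factor[U SE]]|eqr].
  apply/eqP; rewrite eqn_leq qrankM_maxr /=.
  have {1}-> : S = S *m Y *m (T *m A *m S).
    by rewrite {1}SE -XAX -(mulmxA _ X) -SE /X !mulmxA.
  exact: qrankM_maxr.
have [V SV] := qrank_eqr_factor eqr.
have XAS : X *m A *m S = S.
  rewrite /X [in RHS]SV -invY {1}SV.
  by rewrite !mulmxA.
split; first by rewrite {2}/X !mulmxA XAS.
apply/seteqP; split=> _ [x ->].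
  by exists (Y *m T *m x); rewrite /X !mulmxA.
by exists (A *m S *m x); rewrite !mulmxA XAS.
Qed.

(** The mirror image, with pivot [T A X = T], obtained from [T = W X] or from [T = T A S U]. *)
Lemma sandwich_nullP :
  X *m A *m X = X /\ right_null X = right_null T <->
  qrank (T *m A *m S) = qrank T.
Proof.
split=> [[XAX /right_null_factor[W TE]]|].
  apply/eqP; rewrite eqn_leq -{1}mulmxA qrankM_maxl /=.
  have {1}-> : T = T *m A *m S *m (Y *m T).
    by rewrite {1}TE -XAX 2!(mulmxA W) -TE /X !mulmxA.
  exact: qrankM_maxl.
rewrite -mulmxA => /qrank_eql_factor[U TU].
have TAX : T *m A *m X = T.
  rewrite [in RHS]TU (mulmxA T) -invY /X {2}TU.
  by rewrite !mulmxA.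
split; first by rewrite {1}/X -!mulmxA (mulmxA T) TAX mulmxA.
apply/seteqP; split=> x; rewrite /right_null /= => x0.
  by rewrite -TAX -mulmxA x0 mulmx0.
by rewrite /X -mulmxA x0 mulmx0.
Qed.

End Sandwich.
End QuaternionRank.

Theorem theorem4p3 (R : realType) (m n p q nu : nat)
    (A : 'M[quat R]_(m, n)) (hA : qrank A = nu)
    (S1 : 'M[quat R]_(n, p)) (T1 : 'M[quat R]_(q, m))
    (Y : 'M[quat R]_(p, q)) (hY : is_inv1 (T1 *m A *m S1) Y)
    (X : 'M[quat R]_(n, m)) (hX : X = S1 *m Y *m T1) :
  [/\ (A *m X *m A = A <-> qrank (T1 *m A *m S1) = nu),
      (X *m A *m X = X /\ right_range X = right_range S1 <->
         qrank (T1 *m A *m S1) = qrank S1),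
      (X *m A *m X = X /\ right_null X = right_null T1 <->
         qrank (T1 *m A *m S1) = qrank T1),
      (unique (is_inv2_prescribed A S1 T1) X <->
         qrank (T1 *m A *m S1) = qrank S1 /\ qrank S1 = qrank T1)
    & (unique (is_inv12_prescribed A S1 T1) X <->
         [/\ qrank (T1 *m A *m S1) = qrank S1, qrank S1 = qrank T1
           & qrank T1 = nu])].
Proof.
have Pa := sandwich_inv1P hY.
have Pb := sandwich_rangeP hY.
have Pc := sandwich_nullP hY.
rewrite -hX hA in Pa Pb Pc; split=> //.
  (* The range and null space criteria combine; uniqueness comes from [inv2_range_null_inj]. *)
  split=> [[[X2 XR XN] _]|[eS eT]].
    have eS := Pb.1 (conj X2 XR); have eT := Pc.1 (conj X2 XN).
    by rewrite -eS -eT.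
  have [X2 XR] := Pb.2 eS; have [_ XN] := Pc.2 (etrans eS eT).
  split=> // Z [Z2 ZR ZN].
  by apply: (inv2_range_null_inj X2 Z2); rewrite ?ZR ?ZN.
split=> [[[X1 X2 XR XN] _]|[eS eT eA]].
  have eS := Pb.1 (conj X2 XR); have eT := Pc.1 (conj X2 XN).
  by rewrite -eS -eT; split=> //; apply/Pa.
have [X2 XR] := Pb.2 eS; have [_ XN] := Pc.2 (etrans eS eT).
have X1 := Pa.2 (etrans eS (etrans eT eA)).
split=> // Z [Z1 Z2 ZR ZN].
by apply: (inv2_range_null_inj X2 Z2); rewrite ?ZR ?ZN.
Qed.
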